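(* Let $d\ge1$. The operator $T_d:L^2(I_d,\nu_d)\to L^2(I_d,\nu_d)$ defined by $(T_df)(j)=\int_{I_d}K_d(j,l)f(l)\,d\nu_d(l)$ is bounded, compact, self-adjoint, positive (i.e. $\langle T_df,f\rangle\ge0$ for all $f$), and trace class.
   Context: $\mathrm{Corner}(d)$ is the set of all $2^d$ functions $c:\{0,\dots,d-1\}\to\{\mathrm{true},\mathrm{false}\}$, and $I_d=\mathrm{Corner}(d)\times[0,1]^d$ carries the probability measure $\nu_d=2^{-d}\sum_{c}\delta_c\otimes dx$ ($dx$ Lebesgue measure). For $j=(c,p)\in I_d$ let $A_j=\{s\in[0,1]^d:\ \text{for all }k,\ s_k\ge p_k\text{ if }c(k)=\mathrm{true},\ s_k\le p_k\text{ if }c(k)=\mathrm{false}\}$. With $P_0$ the uniform measure on $[0,1]^d$, $K_d(j,l)=P_0(A_j\cap A_l)-P_0(A_j)P_0(A_l)$. *)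

(* Defs.v *)
From HB Require Import structures.
From mathcomp Require Import all_boot all_order all_algebra.
From mathcomp Require Import all_classical all_reals all_analysis.
From mathcomp Require Import measurable_realfun ess_sup_inf.

Set Implicit Arguments.
Unset Strict Implicit.
Unset Printing Implicit Defensive.
Import Order.TTheory GRing.Theory Num.Theory.
Import numFieldNormedType.Exports.

Local Open Scope classical_set_scope.
Local Open Scope ring_scope.

(* The library defines [LspaceType mu p1] as a quotient by a.e. equality but
   gives it no structure; here it becomes a normed module. *)
Section Lspace_normed.
Context d (T : measurableType d) (R : realType).
Variable mu : {measure set T -> \bar R}.
Variables (p : \bar R) (p1 : (1 <= p)%E).

Local Notation Lsp := (LspaceType mu p1).
Local Notation Lfn := (LfunType mu p1).

HB.instance Definition _ := gen_eqMixin Lsp.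
HB.instance Definition _ := gen_choiceMixin Lsp.

Lemma eq_ae_Lnorm (f g : T -> R) :
  measurable_fun setT f -> measurable_fun setT g -> f = g %[ae mu] ->
  ('N[mu]_p[EFin \o f] = 'N[mu]_p[EFin \o g])%E.
Proof.
move=> mf mg fg; rewrite unlock /Lnorm.
case: p p1 => [r r1|_|//].
  congr (_ `^ _)%E; apply: ge0_ae_eq_integral => //.
  - by apply/measurable_EFinP; apply: (measurableT_comp (measurable_powR r));
      exact: measurableT_comp.
  - by apply/measurable_EFinP; apply: (measurableT_comp (measurable_powR r));
      exact: measurableT_comp.
  - by move=> x _; exact: poweR_ge0.
  - by move=> x _; exact: poweR_ge0.
  - exact: (@ae_eq_comp _ _ _ mu setT _ _ (fun y : R => ((`|y%:E| `^ r)%E)) f g fg).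
case: ifP => // _; apply: eq_ess_sup.
by apply: filterS fg => x /(_ I) /= ->.
Qed.

Lemma measurable_Lspace (x : Lsp) : measurable_fun setT (x : T -> R).
Proof.
exact: (measurable_funPT (repr (x : {mfun_ mu, T >-> measurableTypeR R}))).
Qed.

Lemma Lrepr_Lfun (x : Lsp) : (x : T -> R) \in Lfun mu p.
Proof.
apply/andP; split; rewrite inE/=.
  exact: measurable_Lspace.
exact: Lebesgue_finite.
Qed.

Definition Lrepr (x : Lsp) : Lfn := Lfun_Sub p1 (Lrepr_Lfun x).

Section Lclass.
Variable f : Lfn.

Let mf : @isMeasurableFun _ _ T (measurableTypeR R) f :=
  @isMeasurableFun.Build _ _ T (measurableTypeR R) f (measurable_funPT f).

Let fm : {mfun T >-> measurableTypeR R} := HB.pack (f : T -> measurableTypeR R) mf.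

Let c : {mfun_ mu, T >-> measurableTypeR R} := (\pi fm)%qT.

Let c_ae : (c : T -> R) = f %[ae mu].
Proof.
have /eqP := reprK c; rewrite /c eqmodE => /asboolP h.
by apply: filterS h => x h _; exact: h.
Qed.

Lemma Lclass_finite : finite_norm mu p c.
Proof.
have /(_ c_ae) := @eq_ae_Lnorm c f (measurable_funPT (repr c)) (measurable_funPT f).
by rewrite /finite_norm => ->; exact: Lfunction_finite.
Qed.

HB.instance Definition _ := @isFinLebesgue.Build d T R mu p p1 c Lclass_finite.

Definition Lclass : Lsp := c.

Lemma Lclass_ae : (Lclass : T -> R) = f %[ae mu].
Proof. exact: c_ae. Qed.

End Lclass.

Lemma Lspace_eq (x y : Lsp) : (x : T -> R) = y %[ae mu] -> x = y.
Proof.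
move=> xy.
have : (x : {mfun_ mu, T >-> measurableTypeR R}) = y.
  rewrite -[LHS]reprK -[RHS]reprK; apply/eqP; rewrite eqmodE; exact/asboolP.
case: x y {xy} => [x [[cx]]] [y [[cy]]] /= xy.
by move: xy cx cy => -> cx cy; rewrite (Prop_irrelevance cx cy).
Qed.


Lemma Lclass_eq (f g : Lfn) : (f : T -> R) = g %[ae mu] -> Lclass f = Lclass g.
Proof.
move=> fg; apply: Lspace_eq.
apply: ae_eq_trans (Lclass_ae f) (ae_eq_trans fg (ae_eq_sym (Lclass_ae g))).
Qed.

Lemma LreprK : cancel Lrepr Lclass.
Proof. by move=> x; apply: Lspace_eq; exact: Lclass_ae. Qed.

Lemma LclassK (f : Lfn) : (Lrepr (Lclass f) : T -> R) = f %[ae mu].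
Proof. exact: Lclass_ae. Qed.

Let add (x y : Lsp) : Lsp := Lclass (Lrepr x + Lrepr y).
Let opp (x : Lsp) : Lsp := Lclass (- Lrepr x).
Let scale (a : R) (x : Lsp) : Lsp := Lclass (a *: Lrepr x).

Let addE (f g : Lfn) : add (Lclass f) (Lclass g) = Lclass (f + g).
Proof.
apply: Lclass_eq; move: (LclassK f) (LclassK g); apply: filterS2.
by move=> x fx gx _; exact: (congr2 +%R (fx I) (gx I)).
Qed.

Let oppE (f : Lfn) : opp (Lclass f) = Lclass (- f).
Proof.
apply: Lclass_eq; move: (LclassK f); apply: filterS.
by move=> x fx _; exact: (congr1 -%R (fx I)).
Qed.

Let scaleE a (f : Lfn) : scale a (Lclass f) = Lclass (a *: f).
Proof.
apply: Lclass_eq; move: (LclassK f); apply: filterS.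
by move=> x fx _; exact: (congr1 ( *%R a) (fx I)).
Qed.

Let LclassP (P : Lsp -> Prop) : (forall f, P (Lclass f)) -> forall x, P x.
Proof. by move=> h x; rewrite -(LreprK x). Qed.

Let addA : associative add.
Proof.
by do 3!elim/LclassP=> ?; rewrite !addE addrA.
Qed.

Let addC : commutative add.
Proof. by do 2!elim/LclassP=> ?; rewrite !addE addrC. Qed.

Let add0 : left_id (Lclass 0) add.
Proof. by elim/LclassP=> ?; rewrite addE add0r. Qed.

Let addN : left_inverse (Lclass 0) opp add.
Proof. by elim/LclassP=> ?; rewrite oppE addE addNr. Qed.

HB.instance Definition _ := GRing.isZmodule.Build Lsp addA addC add0 addN.

Let scaleA a b x : scale a (scale b x) = scale (a * b) x.
Proof. by elim/LclassP: x => ?; rewrite !scaleE scalerA. Qed.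

Let scale1 : left_id 1 scale.
Proof. by elim/LclassP=> ?; rewrite scaleE scale1r. Qed.

Let scaleDr : right_distributive scale +%R.
Proof. by move=> a; do 2!elim/LclassP=> ?; rewrite [_ + _]addE !scaleE [RHS]addE scalerDr. Qed.

Let scaleDl x : {morph scale^~ x : a b / a + b}.
Proof. by elim/LclassP: x => ? a b; rewrite !scaleE [RHS]addE scalerDl. Qed.

HB.instance Definition _ := GRing.Zmodule_isLmodule.Build R Lsp
  scaleA scale1 scaleDr scaleDl.

Let nm (x : Lsp) : R := fine 'N[mu]_p[EFin \o (x : T -> R)]%E.

Let nmE (f : Lfn) : nm (Lclass f) = fine 'N[mu]_p[EFin \o f]%E.
Proof.
rewrite /nm; congr fine; apply: eq_ae_Lnorm; last exact: Lclass_ae.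
- exact: measurable_Lspace.
- exact: (measurable_funPT f).
Qed.

Let nmD x y : nm (x + y) <= nm x + nm y.
Proof.
elim/LclassP: x => f; elim/LclassP: y => g; rewrite [_ + _ in leLHS]addE !nmE.
exact: ler_LnormD.
Qed.

Let nmZ a x : nm (a *: x) = `|a| * nm x.
Proof.
elim/LclassP: x => f; rewrite [a *: _]scaleE !nmE.
rewrite [X in fine X](LnormZ f a) fineM//.
by rewrite -finite_norm_fine.
Qed.

Let nm0_eq0 x : nm x = 0 -> x = 0.
Proof.
elim/LclassP: x => f; rewrite nmE => /fine_Lnormr_eq0 f0.
exact: Lclass_eq.
Qed.

HB.instance Definition _ := @Lmodule_isNormed.Build R Lsp nm nmD nmZ nm0_eq0.

Lemma normLspaceE (x : Lsp) : `|x| = fine 'N[mu]_p[EFin \o (x : T -> R)]%E.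
Proof. by []. Qed.

Lemma LspaceD (x y : Lsp) : (x + y : Lsp) = (x : T -> R) \+ y %[ae mu].
Proof. exact: (Lclass_ae (Lrepr x + Lrepr y)). Qed.

Lemma LspaceZ a (x : Lsp) : (a *: x : Lsp) = a \*o (x : T -> R) %[ae mu].
Proof. exact: (Lclass_ae (a *: Lrepr x)). Qed.

End Lspace_normed.

Definition L2dot d (T : measurableType d) (R : realType)
    (mu : {measure set T -> \bar R}) (f g : LspaceType2 mu) : R :=
  \int[mu]_x (f x * g x).

Section operators.
Context (R : realType) (V : normedModType R) (dot : V -> V -> R).
Implicit Types (A B : V -> V) (E : set V).

Definition bounded_op A := exists M : R, forall x, `|A x| <= M * `|x|.

Definition compact_op A :=
  forall B : set V, bounded_set B -> precompact (A @` B).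

Definition adjoint_op A B := forall x y, dot (A x) y = dot x (B y).

Definition self_adjoint_op A := adjoint_op A A.

Definition positive_op A := forall x, 0 <= dot (A x) x.

(* B = (A^* A)^(1/2), with A' = A^*. *)
Definition absolute_value_op A (B : {linear V -> V}) :=
  [/\ bounded_op B, self_adjoint_op B, positive_op B
    & exists2 A' : V -> V, adjoint_op A A' & forall x, B (B x) = A' (A x)].

Definition orthonormal E :=
  forall x y, E x -> E y -> dot x y = (x == y)%:R.

Definition orthonormal_basis E :=
  orthonormal E /\ forall F, orthonormal F -> E `<=` F -> F = E.

(* The sum does not depend on the choice of the orthonormal basis E. *)
Definition trace_class_op A :=
  bounded_op A /\ exists B : {linear V -> V}, absolute_value_op A B /\
    exists2 E, orthonormal_basis E & (\esum_(e in E) (dot (B e) e)%:E < +oo)%E.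

End operators.

Section cube_measure.
Context (R : realType).
Local Notation mR := (measurableTypeR R).

Definition cons_pair n (x : mR * n.-tuple mR) : n.+1.-tuple mR :=
  [tuple of x.1 :: x.2].

Lemma measurable_cons_pair n : measurable_fun setT (@cons_pair n).
Proof. exact: measurable_cons. Qed.

HB.instance Definition _ n :=
  isMeasurableFun.Build _ _ _ _ (@cons_pair n) (@measurable_cons_pair n).

(* Lebesgue measure on [0,1]^n, viewed as a probability on R^n, and built one
   coordinate at a time. *)
Fixpoint P0 n : probability (n.-tuple mR) R :=
  if n is n'.+1 then
    distribution (uniform_prob (@ltr01 R) \x P0 n')%E (@cons_pair n')
  else \d_[tuple].

Lemma P0_box n (B : 'I_n -> set mR) : (forall i, measurable (B i)) ->
  P0 n [set s | forall i, B i (tnth s i)] =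
  (\prod_(i < n) uniform_prob (@ltr01 R) (B i))%E.
Proof.
elim: n B => [|n IH] B mB.
  rewrite big_ord0 /= /dirac indicE mem_set//= => -[].
  by [].
rewrite big_ord_recl -IH//= /distribution /pushforward.
rewrite [X in (_ \x _)%E X](_ : _ =
    B ord0 `*` [set s | forall i, B (lift ord0 i) (tnth s i)]).
  rewrite product_measure1E//.
  rewrite (_ : [set _ | _] = \bigcap_(i in [set: 'I_n])
      (fun s => tnth s i) @^-1` B (lift ord0 i)); last first.
    by apply/seteqP; split => s /= h i; [move=> _; exact: h|exact: h].
  apply: fin_bigcap_measurable => //= i _.
  by rewrite -[_ @^-1` _]setTI; exact: measurable_tnth.
apply/seteqP; split => -[x s] /=.
  move=> h; split; first exact: (h ord0).
  by move=> i; have := h (lift ord0 i); rewrite /cons_pair tnthS.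
move=> [h0 h] i.
case: (unliftP ord0 i) => [j ->|->//].
by rewrite /cons_pair tnthS; exact: h.
Qed.

End cube_measure.

Section kernel.
Context (R : realType) (d : nat).
Local Notation mR := (measurableTypeR R).
Local Notation Corner := (d.-tuple bool).

(* The functions c from {0,...,d-1} to booleans are represented by d.-tuple bool.
   As P0 R d is carried by the unit cube, nu is carried by
   I_d = Corner(d) * [0,1]^d, so that L^2(nu) is L^2(I_d, nu_d). *)
Definition nu (A : set (Corner * d.-tuple mR)) : \bar R :=
  ((2 ^- d : R)%:E * \sum_(c : Corner) (\d_c \x P0 R d) A)%E.

Let m (k : nat) : {measure set (Corner * d.-tuple mR) -> \bar R} :=
  (\d_(nth point (index_enum Corner) k) \x P0 R d)%E.

Let r : {nonneg R} := (2^-1 ^+ d)%:nng.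

Let nuE : nu = mscale r (msum m (size (index_enum Corner))).
Proof.
apply/funext => A; rewrite /nu /mscale /msum /= exprVn; congr (_ * _)%E.
by rewrite (big_nth point) big_mkord.
Qed.

Let nu0 : nu set0 = 0%E.
Proof. by rewrite nuE measure0. Qed.

Let nu_ge0 A : (0 <= nu A)%E.
Proof. by rewrite nuE measure_ge0. Qed.

Let nu_sigma_additive : semi_sigma_additive nu.
Proof. rewrite nuE; exact: measure_semi_sigma_additive. Qed.

Let nu_setT : nu setT = 1%E.
Proof.
rewrite /nu (eq_bigr (fun=> 1%E)); last first.
  by move=> c _; exact: probability_setT.
rewrite sumEFin -EFinM; congr EFin.
by rewrite sumr_const card_tuple card_bool natrX mulVf// expf_neq0.
Qed.

HB.instance Definition _ := isMeasure.Build _ _ _ nu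
  nu0 nu_ge0 nu_sigma_additive.
HB.instance Definition _ := Measure_isProbability.Build _ _ _ nu nu_setT.

Definition A_ (j : Corner * d.-tuple mR) : set (d.-tuple mR) :=
  [set s | forall k : 'I_d,
     let sk : R := tnth s k in let pk : R := tnth j.2 k in
     0 <= sk <= 1 /\ (if tnth j.1 k then pk <= sk else sk <= pk)].

Definition K_ (j l : Corner * d.-tuple mR) : R :=
  fine (P0 R d (A_ j `&` A_ l)) - fine (P0 R d (A_ j)) * fine (P0 R d (A_ l)).

End kernel.

Arguments nu : clear implicits.

(* Main.v *)
Require Import Defs.
From HB Require Import structures.
From mathcomp Require Import all_boot all_order all_algebra finmap.
From mathcomp Require Import all_classical all_reals all_analysis.
From mathcomp Require Import measurable_realfun ring lra.
Import Order.TTheory GRing.Theory Num.Theory.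
Import numFieldNormedType.Exports.

Set Implicit Arguments.
Unset Strict Implicit.
Unset Printing Implicit Defensive.

Local Open Scope classical_set_scope.
Local Open Scope ring_scope.

(* K_d(j, l) is the covariance of the indicators of A_j and A_l, hence the Gram
   kernel of the centered indicators phi_j = 1_{A_j} - P0(A_j): it is the integral
   of phi_j phi_l against P0. Put Sf(s) = \int phi_j(s) f(j) dnu(j). By Fubini,
   <Tf, g> = <Sf, Sg>, so T is self-adjoint and positive, and T is its own
   absolute value. Bessel's inequality for the functions j |-> phi_j(s), of norm at
   most 1, bounds the trace by 1.

   For compactness, T maps the ball of radius M to functions bounded by M and
   M-Lipschitz for the pseudometric w(j, l) = \int |phi_j - phi_l| dP0. The index
   set is totally bounded for w (round the corner positions to a grid), so on this
   family pointwise convergence is uniform convergence. The family is compact for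
   pointwise convergence by Tychonoff, and therefore so is its image in L^2. *)

(** * The Hilbert space structure of L2 *)

Section L2_theory.
Context d (T : measurableType d) (R : realType).
Variable mu : {measure set T -> \bar R}.
Local Notation L2 := (LspaceType2 mu).
Implicit Types x y z : L2.

Lemma ae_eq_Rintegral (f g : T -> R) :
  measurable_fun setT f -> measurable_fun setT g -> f = g %[ae mu] ->
  \int[mu]_t f t = \int[mu]_t g t.
Proof.
move=> mf mg fg; congr fine; apply: ae_eq_integral => //; try exact/measurable_EFinP.
by apply: filterS fg => t /(_ I) /= -> _.
Qed.

Lemma integrable_L2M x y : mu.-integrable setT (EFin \o (fun t => x t * y t)).
Proof.
by apply/Lfun1_integrable; apply: Lfun2_mul_Lfun1; exact: Lrepr_Lfun.
Qed.

Lemma measurable_L2M x y : measurable_fun setT (fun t => x t * y t).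
Proof. by apply: measurable_funM; exact: measurable_Lspace. Qed.

Lemma L2dotC x y : L2dot x y = L2dot y x.
Proof. by apply: eq_Rintegral => t _; rewrite mulrC. Qed.

Lemma L2dotDl x y z : L2dot (x + y) z = L2dot x z + L2dot y z.
Proof.
rewrite /L2dot -RintegralD//; [|exact: integrable_L2M|exact: integrable_L2M].
apply: ae_eq_Rintegral; [exact: measurable_L2M| |].
  by apply: measurable_funD; exact: measurable_L2M.
by apply: filterS (LspaceD x y) => t /(_ I) /= -> _; rewrite mulrDl.
Qed.

Lemma L2dotZl a x y : L2dot (a *: x) y = a * L2dot x y.
Proof.
rewrite /L2dot -RintegralZl//; [|exact: integrable_L2M].
apply: ae_eq_Rintegral; [exact: measurable_L2M| |].
  by apply: measurable_funM => //; exact: measurable_L2M.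
by apply: filterS (LspaceZ a x) => t /(_ I) /= -> _; rewrite mulrA.
Qed.

Lemma L2dot0l x : L2dot 0 x = 0.
Proof. by rewrite -(scale0r x) L2dotZl mul0r. Qed.

Lemma L2dotBl x y z : L2dot (x - y) z = L2dot x z - L2dot y z.
Proof. by rewrite L2dotDl -scaleN1r L2dotZl mulN1r. Qed.

Lemma LspaceB x y : (x - y : L2) = (x : T -> R) \- y %[ae mu].
Proof.
rewrite -scaleN1r.
apply: filterS2 (LspaceD x (-1 *: y)) (LspaceZ (-1) y) => t /(_ I) /= -> /(_ I) /= -> _.
by rewrite mulN1r.
Qed.

Lemma L2dot_suml (I : Type) (s : seq I) (F : I -> L2) x :
  L2dot (\sum_(i <- s) F i) x = \sum_(i <- s) L2dot (F i) x.
Proof.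
elim: s => [|i s IH]; first by rewrite !big_nil L2dot0l.
by rewrite !big_cons L2dotDl IH.
Qed.

Lemma L2dot_ge0 x : 0 <= L2dot x x.
Proof. by apply: Rintegral_ge0 => t _; rewrite -expr2 sqr_ge0. Qed.

Lemma L2norm_sqr x : `|x| ^+ 2 = L2dot x x.
Proof.
have fin : ('N[mu]_2%:E[EFin \o (x : T -> R)] \is a fin_num)%E.
  rewrite ge0_fin_numE ?Lnorm_ge0//; exact: (@Lebesgue_finite _ _ _ _ _ _ x).
rewrite normLspaceE -powR_mulrn; last by rewrite fine_ge0// Lnorm_ge0.
transitivity (fine ('N[mu]_2%:E[EFin \o (x : T -> R)] `^ 2)%E).
  by rewrite -{2}(fineK fin) poweR_EFin.
rewrite poweR_Lnorm//; congr fine; apply: eq_integral => t _ /=.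
by rewrite powR_mulrn// real_normK ?num_real// expr2.
Qed.

(** Let p be the orthogonal projection of x onto the span of [s]. Then [<p,p> = <p,x>], so
    [0 <= <x-p,x-p>] reduces to [<x,x> - <p,x>], and [<p,x>] is the sum of squares. *)
Lemma bessel (s : seq L2) x : uniq s ->
  {in s &, forall e e', L2dot e e' = (e == e')%:R} ->
  \sum_(e <- s) L2dot x e ^+ 2 <= L2dot x x.
Proof.
move=> us os; pose p := \sum_(e <- s) L2dot x e *: e.
have dotp e : e \in s -> L2dot p e = L2dot x e.
  move=> es; rewrite L2dot_suml (bigD1_seq e)//= L2dotZl (os e e)// eqxx mulr1.
  rewrite big_seq_cond big1 ?addr0// => i /andP[is_ /negbTE ie].
  by rewrite L2dotZl (os i e)// ie mulr0.
have dotx y : L2dot p y = \sum_(e <- s) L2dot x e * L2dot y e.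
  by rewrite L2dot_suml; apply: eq_bigr => e _; rewrite L2dotZl (L2dotC e).
have pp : L2dot p p = L2dot p x.
  rewrite !dotx big_seq [RHS]big_seq; apply: eq_bigr => e es.
  by rewrite dotp.
have := L2dot_ge0 (x - p).
rewrite L2dotBl (L2dotC _ (x - p)) (L2dotC p (x - p)) !L2dotBl (L2dotC x p) pp subrr subr0.
by rewrite subr_ge0 dotx; under eq_bigr do rewrite -expr2.
Qed.

(** Zorn's lemma: two vectors in the union of a chain of orthonormal sets already lie in one member
    of the chain, so the union is orthonormal. *)
Lemma exists_orthonormal_basis : exists E, orthonormal_basis (@L2dot _ T R mu) E.
Proof.
have [|E [oE mE]] := @Zorn_bigcup L2 (Defs.orthonormal (@L2dot _ T R mu)).
  move=> F oF tF x y [A FA Ax] [B FB By].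
  by have [AB|BA] := tF _ _ FA FB;
    [apply: (oF _ FB) => //; exact: AB|apply: (oF _ FA) => //; exact: BA].
exists E; split=> // F oF EF; apply: contrapT => FE; apply: (mE F) => //.
split=> // FsubE; apply: FE; exact/seteqP.
Qed.

End L2_theory.

(** * Bounded functions and norm comparisons in L2 of a probability measure *)

Section L2_probability.
Context d (T : measurableType d) (R : realType) (P : probability T R).
Local Notation L2 := (LspaceType2 P).

Lemma Rintegral_cst_probability (c : R) : \int[P]_t c = c.
Proof.
have PT : (P [set: T] = 1)%E by exact: probability_setT.
by rewrite Rintegral_cst//= PT mulr1.
Qed.

Lemma bounded_integrable (f : T -> R) (M : R) : measurable_fun setT f ->
  (forall t, `|f t| <= M) -> P.-integrable setT (EFin \o f).
Proof.
move=> mf fM; apply: measurable_bounded_integrable => //.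
  by rewrite (le_lt_trans (probability_le1 _ _))// ltry.
exists M; split; first exact: num_real.
by move=> x Mx t _; exact: le_trans (fM t) (ltW Mx).
Qed.

Lemma bounded_Lfun2 (f : T -> R) (M : R) : measurable_fun setT f ->
  (forall t, `|f t| <= M) -> f \in Lfun P 2%:E.
Proof.
move=> mf fM; have M0 : 0 <= M by exact: le_trans (fM point).
apply/andP; split; rewrite inE//=.
rewrite /finite_norm unlock poweR_lty//.
rewrite (@le_lt_trans _ _ (\int[P]_x (M `^ 2)%:E)%E)//; last first.
  have PT : (P [set: T] = 1)%E by exact: probability_setT.
  by rewrite integral_cst//= PT mule1 ltry.
apply: ge0_le_integral => //=.
- apply/measurable_EFinP/(measurableT_comp (measurable_powR 2)).
  exact: measurableT_comp.
- by move=> t _; rewrite lee_fin ge0_ler_powR// nnegrE.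
Qed.

Definition bounded_L2 (f : T -> R) (M : R) (mf : measurable_fun setT f)
  (fM : forall t, `|f t| <= M) : L2 := Lclass (Lfun_Sub (lee1n 2) (bounded_Lfun2 mf fM)).

Lemma bounded_L2E (f : T -> R) (M : R) mf fM : (@bounded_L2 f M mf fM : T -> R) = f %[ae P].
Proof. exact: Lclass_ae. Qed.

Lemma L2norm_le (x : L2) (M : R) : 0 <= M -> {ae P, forall t, `|x t| <= M} -> `|x| <= M.
Proof.
move=> M0 xM; rewrite -(@ler_pXn2r _ 2)// ?nnegrE// L2norm_sqr.
(* The bound on x holds only a.e. Truncating x^2 at M^2 gives an a.e. equal integrand that is
   bounded at every point, as [le_Rintegral] requires. *)
rewrite /L2dot (@ae_eq_Rintegral _ _ _ _ _ (fun t => Num.min (x t * x t) (M ^+ 2))).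
- have mm : measurable_fun setT (fun t => Num.min (x t * x t) (M ^+ 2)).
    by apply: measurable_minr => //; exact: measurable_L2M.
  rewrite -[leRHS]Rintegral_cst_probability.
  apply: le_Rintegral => //.
  + apply: (@bounded_integrable _ (M ^+ 2)) => // t.
    rewrite ger0_norm ?ge_min ?lexx ?orbT//.
    by rewrite le_min -expr2 !sqr_ge0.
  + by apply: (@bounded_integrable _ (M ^+ 2)) => // t; rewrite ger0_norm// sqr_ge0.
  + by move=> t _; rewrite ge_min lexx orbT.
- exact: measurable_L2M.
- by apply: measurable_minr => //; exact: measurable_L2M.
- apply: filterS xM => t xM _; rewrite min_l//.
  by rewrite -expr2 -real_normK ?num_real// ler_pXn2r// nnegrE.
Qed.

Lemma integrable_L2 (x : L2) : P.-integrable setT (EFin \o (x : T -> R)).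
Proof.
apply/Lfun1_integrable/Lfun_subset12; last exact: Lrepr_Lfun.
exact: fin_num_measure.
Qed.

(** With c the mean of |x|, expand [0 <= \int (|x| - c)^2]: the variance of |x| is nonnegative. *)
Lemma Rintegral_norm_le (x : L2) : \int[P]_t `|x t| <= `|x|.
Proof.
have i1 : P.-integrable setT (EFin \o (fun t => `|x t|)).
  have := integrable_abse (integrable_L2 x); apply: eq_integrable => //.
have ic (c : R) : P.-integrable setT (EFin \o (fun _ : T => c)).
  by apply: (@bounded_integrable _ `|c|).
have i0 : 0 <= \int[P]_t `|x t| by apply: Rintegral_ge0.
rewrite -(@ler_pXn2r _ 2)// ?nnegrE// L2norm_sqr.
set c := \int[P]_t `|x t|.
have i2 : P.-integrable setT (EFin \o (fun t => 2 * c * `|x t|)).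
  have := integrableZl measurableT (2 * c) i1; apply: eq_integrable => //.
have : 0 <= \int[P]_t (x t * x t + c ^+ 2 - 2 * c * `|x t|).
  apply: Rintegral_ge0 => t _.
  have -> (a : R) : a * a + c ^+ 2 - 2 * c * `|a| = (`|a| - c) ^+ 2.
    by rewrite -expr2 -(real_normK (num_real a)); ring.
  exact: sqr_ge0.
rewrite RintegralB//; last first.
  have := integrableD measurableT (integrable_L2M x x) (ic (c ^+ 2)).
  exact: eq_integrable.
rewrite RintegralD//; last exact: integrable_L2M.
rewrite Rintegral_cst_probability RintegralZl// -/c -/(L2dot x x) -subr_ge0.
by set b := L2dot x x; have -> : b - c ^+ 2 = b + c ^+ 2 - 2 * c * c by ring.
Qed.

End L2_probability.

(** * Operators with a Gram kernel *)

Section bounded_kernel.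
Context d1 d2 (X : measurableType d1) (S : measurableType d2) (R : realType).
Context (nu : probability X R) (P : probability S R).
Variables (b : X * S -> R) (M : R) (f : X -> R).
Hypothesis mb : measurable_fun setT b.
Hypothesis bM : forall z, `|b z| <= M.
Hypothesis intf : nu.-integrable setT (EFin \o f).

Let mf : measurable_fun setT f.
Proof. by apply/measurable_EFinP; exact: measurable_int intf. Qed.

Let M0 : 0 <= M. Proof. exact: le_trans (bM point). Qed.

Let g z := b z * f z.1.

Let mg : measurable_fun setT g.
Proof. by apply: measurable_funM => //; exact: measurableT_comp. Qed.

Let intgx x : P.-integrable setT (EFin \o (fun s => b (x, s) * f x)).
Proof.
apply: (@bounded_integrable _ _ _ _ _ (M * `|f x|)).
  by apply: measurable_funM => //; exact: measurableT_comp.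
by move=> s; rewrite normrM ler_wpM2r.
Qed.

Let intgs s : nu.-integrable setT (EFin \o (fun x => b (x, s) * f x)).
Proof.
have := integrableZl measurableT M intf; apply: le_integrable => //=.
  apply/measurable_EFinP; apply: measurable_funM => //.
  exact: measurableT_comp.
by move=> x _; rewrite lee_fin !normrM ler_wpM2r// (ger0_norm M0).
Qed.

(** Integrating out s first, where P has mass 1, bounds the double integral of |g| by that of
    [M |f|], which is finite. *)
Let intg : (nu \x P)%E.-integrable setT (EFin \o g).
Proof.
apply/integrable12ltyP; first exact/measurable_EFinP.
have := integrableZl measurableT M intf => /integrableP[_]; apply: le_lt_trans.
apply: ge0_le_integral => //=.
- by move=> x _; exact: integral_ge0.
- apply: (measurable_fun_fubini_tonelli_F (fun z => `|g z|%:E)) => //.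
  by apply/measurable_EFinP; exact: measurableT_comp.
- do 2 apply: measurableT_comp => //.
  by apply: measurable_funM.
move=> x _.
have PT : (P [set: S] = 1)%E by exact: probability_setT.
rewrite -[leRHS]mule1 -PT -integral_cst//=.
apply: ge0_le_integral => //=.
- by apply/measurable_EFinP/measurableT_comp => //; exact: measurableT_comp.
- by move=> s _; rewrite lee_fin !normrM ler_wpM2r// (ger0_norm M0).
Qed.

Lemma measurable_kernel_l : measurable_fun setT (fun x => \int[P]_s (b (x, s) * f x)).
Proof. by apply: measurableT_comp => //; exact: measurable_fubini_F intg. Qed.

Lemma measurable_kernel_r : measurable_fun setT (fun s => \int[nu]_x (b (x, s) * f x)).
Proof. by apply: measurableT_comp => //; exact: measurable_fubini_G intg. Qed.

Lemma Fubini_kernel : \int[nu]_x \int[P]_s (b (x, s) * f x) =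
  \int[P]_s \int[nu]_x (b (x, s) * f x).
Proof.
congr fine; transitivity (\int[nu]_x \int[P]_s (b (x, s) * f x)%:E)%E.
  (* Real integrals are [fine] of extended ones; the inner integrals are finite, so [fine] can be
     removed on both sides of Fubini's theorem. *)
  by apply: eq_integral => x _; rewrite fineK//; exact: integrable_fin_num (intgx x).
rewrite (Fubini intg).
by apply: eq_integral => s _; rewrite fineK//; exact: integrable_fin_num (intgs s).
Qed.

End bounded_kernel.

Section L2_bounded_factor.
Context d (T : measurableType d) (R : realType) (P : probability T R).
Variables (k : T -> R) (c : R) (f : LspaceType2 P).
Hypothesis mk : measurable_fun setT k.
Hypothesis kc : forall t, `|k t| <= c.

Lemma integrable_boundedM : P.-integrable setT (EFin \o (fun t => k t * f t)).
Proof.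
have c0 : 0 <= c by exact: le_trans (kc point).
have := integrableZl measurableT c (integrable_L2 f); apply: le_integrable => //=.
  by apply/measurable_EFinP; apply: measurable_funM => //; exact: measurable_Lspace.
by move=> x _; rewrite lee_fin !normrM ler_wpM2r// (ger0_norm c0).
Qed.

Lemma normr_Rintegral_boundedM : `|\int[P]_t (k t * f t)| <= c * `|f|.
Proof.
have c0 : 0 <= c by exact: le_trans (kc point).
rewrite (le_trans (le_normr_Rintegral measurableT integrable_boundedM))//.
have i1 : P.-integrable setT (EFin \o (fun t => `|f t|)).
  by have := integrable_abse (integrable_L2 f); exact: eq_integrable.
rewrite (@le_trans _ _ (\int[P]_t (c * `|f t|)))//.
  apply: le_Rintegral => //.
  - by have := integrable_abse integrable_boundedM; exact: eq_integrable.
  - by have := integrableZl measurableT c i1; exact: eq_integrable.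
  - by move=> t _; rewrite normrM ler_wpM2r.
by rewrite RintegralZl// ler_wpM2l// Rintegral_norm_le.
Qed.

End L2_bounded_factor.

(** * The operator T = S^* S of a Gram kernel, and its trace *)

Section gram_operator.
Context d1 d2 (X : measurableType d1) (S : measurableType d2) (R : realType).
Context (nu : probability X R) (P : probability S R).
Variable phi : X * S -> R.
Hypothesis mphi : measurable_fun setT phi.
Hypothesis phi1 : forall z, `|phi z| <= 1.
Local Notation L2 := (LspaceType2 nu).
Implicit Types f g : L2.

Definition gram_kernel j l := \int[P]_s (phi (j, s) * phi (l, s)).

Let mphil j : measurable_fun setT (fun s => phi (j, s)).
Proof. exact: measurableT_comp. Qed.

Let mphir s : measurable_fun setT (fun j => phi (j, s)).
Proof. exact: measurableT_comp. Qed.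

Let phi2 j l s : `|phi (j, s) * phi (l, s)| <= 1.
Proof. by rewrite normrM mulr_ile1. Qed.

Let intphi2 j l : P.-integrable setT (EFin \o (fun s => phi (j, s) * phi (l, s))).
Proof. by apply: (@bounded_integrable _ _ _ _ _ 1) => //; exact: measurable_funM. Qed.

Let integrable1 : nu.-integrable setT (EFin \o (fun _ : X => 1 : R)).
Proof. by apply: (@bounded_integrable _ _ _ _ _ 1) => // x; rewrite normr1. Qed.

Lemma measurable_gram_kernel j : measurable_fun setT (gram_kernel j).
Proof.
(* The factor 1 casts the integral in the shape of [measurable_kernel_l], with the constant function
   1 as f. *)
rewrite (_ : gram_kernel j =
    fun l => \int[P]_s (phi (j, (l, s).2) * phi ((l, s).1, (l, s).2) * 1)).
  apply: (@measurable_kernel_l _ _ X S R nu P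
    (fun z => phi (j, z.2) * phi (z.1, z.2)) 1 (fun=> 1)) => //.
  apply: measurable_funM.
    by apply: (@measurableT_comp _ _ _ _ _ _ (fun s => phi (j, s))).
  by apply: eq_measurable_fun mphi => -[].
by apply/funext => l; apply: eq_Rintegral => s _; rewrite mulr1.
Qed.

Lemma normr_gram_kernel j l : `|gram_kernel j l| <= 1.
Proof.
rewrite (le_trans (le_normr_Rintegral measurableT (intphi2 j l)))//.
rewrite -[leRHS](Rintegral_cst_probability P); apply: le_Rintegral => //.
  by have := integrable_abse (intphi2 j l); exact: eq_integrable.
by apply: (@bounded_integrable _ _ _ _ _ 1) => // x; rewrite normr1.
Qed.

Definition gram_fun f j := \int[nu]_l (gram_kernel j l * f l).

Definition gram_factor f s := \int[nu]_j (phi (j, s) * f j).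

Lemma measurable_gram_factor f : measurable_fun setT (gram_factor f).
Proof. exact: measurable_kernel_r mphi phi1 (integrable_L2 f). Qed.

Lemma normr_gram_factor f s : `|gram_factor f s| <= `|f|.
Proof.
by rewrite -[leRHS]mul1r; exact: (@normr_Rintegral_boundedM _ _ _ _ (fun j => phi (j, s))).
Qed.

(** The factorisation Tf = S^*(Sf): unfold the kernel and exchange the integrals over l and s. *)
Lemma gram_funE f j : gram_fun f j = \int[P]_s (phi (j, s) * gram_factor f s).
Proof.
transitivity (\int[nu]_l \int[P]_s (phi (j, (l, s).2) * phi (l, s) * f l)).
  apply: eq_Rintegral => l _; rewrite -RintegralZr//.
rewrite (@Fubini_kernel _ _ _ _ _ nu P (fun z => phi (j, z.2) * phi z) 1 f).
- apply: eq_Rintegral => s _; rewrite -RintegralZl//=.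
    by apply: eq_Rintegral => l _; rewrite mulrA.
  exact: (@integrable_boundedM _ _ _ _ (fun l => phi (l, s)) 1).
- apply: measurable_funM => //.
  by apply: (@measurableT_comp _ _ _ _ _ _ (fun s => phi (j, s))).
- by move=> [l s].
- exact: integrable_L2.
Qed.

(** The integrand of S^*(Sf), taken as a bounded kernel on [X * S] so that the lemmas on bounded
    kernels apply a second time. *)
Let b f z := phi z * gram_factor f z.2.

Let mb f : measurable_fun setT (b f).
Proof.
apply: measurable_funM => //.
by apply: measurableT_comp => //; exact: measurable_gram_factor.
Qed.

Let bM f z : `|b f z| <= `|f|.
Proof.
by rewrite normrM -[leRHS]mul1r ler_pM// normr_gram_factor.
Qed.

Lemma measurable_gram_fun f : measurable_fun setT (gram_fun f).
Proof.
rewrite (_ : gram_fun f = fun j => \int[P]_s (b f (j, s) * 1)).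
  exact: (measurable_kernel_l P (mb f) (bM f) integrable1).
apply/funext => j; rewrite gram_funE.
by apply: eq_Rintegral => s _; rewrite mulr1.
Qed.

Lemma normr_gram_fun f j : `|gram_fun f j| <= `|f|.
Proof.
rewrite -[leRHS]mul1r; apply: normr_Rintegral_boundedM.
  exact: measurable_gram_kernel.
exact: normr_gram_kernel.
Qed.

Definition gram_op f : L2 :=
  bounded_L2 nu (measurable_gram_fun f) (normr_gram_fun f).

Lemma gram_opE f : (gram_op f : X -> R) = gram_fun f %[ae nu].
Proof. exact: bounded_L2E. Qed.

Lemma gram_op_linear : linear gram_op.
Proof.
move=> a f g; apply: Lspace_eq.
(* Integrals ignore null sets, so [gram_fun] is linear at every point j; only the operations on the
   output classes hold a.e. *)
have h : gram_fun (a *: f + g) = fun j => a * gram_fun f j + gram_fun g j.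
  apply/funext => j.
  have i (h : L2) := integrable_boundedM h (@measurable_gram_kernel j) (@normr_gram_kernel j).
  rewrite /gram_fun -RintegralZl//.
  have iz : nu.-integrable setT (EFin \o (fun l => a * (gram_kernel j l * f l))).
    by have := integrableZl measurableT a (i f); exact: eq_integrable.
  rewrite -RintegralD//.
  apply: ae_eq_Rintegral.
  - apply: measurable_funM; [exact: measurable_gram_kernel|exact: measurable_Lspace].
  - apply: measurable_funD; last first.
      apply: measurable_funM; [exact: measurable_gram_kernel|exact: measurable_Lspace].
    apply: measurable_funM => //.
    apply: measurable_funM; [exact: measurable_gram_kernel|exact: measurable_Lspace].
  - apply: filterS2 (LspaceD (a *: f) g) (LspaceZ a f) => l /(_ I) /= -> /(_ I) /= -> _.
    by ring.
apply: ae_eq_trans (gram_opE _) _; rewrite h.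
near=> x => _.
have -> : (a *: gram_op f + gram_op g : L2) x = (a *: gram_op f) x + gram_op g x.
  by near: x; apply: filterS (LspaceD (a *: gram_op f) (gram_op g)) => x /(_ I).
have -> : (a *: gram_op f : L2) x = a * gram_op f x.
  by near: x; apply: filterS (LspaceZ a (gram_op f)) => x /(_ I).
have -> : gram_op f x = gram_fun f x.
  by near: x; apply: filterS (gram_opE f) => x /(_ I).
by have -> : gram_op g x = gram_fun g x
  by near: x; apply: filterS (gram_opE g) => x /(_ I).
Unshelve. all: by end_near. Qed.

HB.instance Definition _ :=
  GRing.isLinear.Build R L2 L2 *:%R gram_op gram_op_linear.

Lemma gram_op_bounded : bounded_op gram_op.
Proof.
exists 1 => f; rewrite mul1r; apply: L2norm_le => //.
by apply: filterS (gram_opE f) => j /(_ I) ->; exact: normr_gram_fun.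
Qed.

Lemma gram_op_dot f g :
  L2dot (gram_op f) g = \int[P]_s (gram_factor f s * gram_factor g s).
Proof.
transitivity (\int[nu]_j (gram_fun f j * g j)).
  apply: ae_eq_Rintegral.
  - exact: measurable_L2M.
  - apply: measurable_funM; [exact: measurable_gram_fun|exact: measurable_Lspace].
  - by apply: filterS (gram_opE f) => j /(_ I) -> _.
transitivity (\int[nu]_j \int[P]_s (b f (j, s) * g j)).
  apply: eq_Rintegral => j _; rewrite gram_funE -RintegralZr//.
  apply: (@bounded_integrable _ _ _ _ _ `|f|).
    by apply: measurable_funM => //; exact: measurable_gram_factor.
  by move=> s; exact: (bM f (j, s)).
rewrite (@Fubini_kernel _ _ _ _ _ _ _ (b f) `|f|)//; last exact: integrable_L2.
apply: eq_Rintegral => s _; rewrite /gram_factor -RintegralZl//.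
  by apply: eq_Rintegral => j _; rewrite /b/= /gram_factor; ring.
exact: (@integrable_boundedM _ _ _ _ (fun l => phi (l, s)) 1).
Qed.

Lemma gram_op_self_adjoint : self_adjoint_op (@L2dot _ _ _ nu) gram_op.
Proof.
move=> f g; rewrite [RHS]L2dotC !gram_op_dot.
by apply: eq_Rintegral => s _; rewrite mulrC.
Qed.

Lemma gram_op_positive : positive_op (@L2dot _ _ _ nu) gram_op.
Proof.
by move=> f; rewrite gram_op_dot; apply: Rintegral_ge0 => s _; rewrite -expr2 sqr_ge0.
Qed.

(** The function j |-> phi(j, s) as a vector of L2: Sf(s) becomes an inner product with it, to which
    Bessel's inequality applies. *)
Let phi_row s : L2 := bounded_L2 nu (mphir s) (fun j => phi1 (j, s)).

Let gram_factor_dot f s : gram_factor f s = L2dot (phi_row s) f.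
Proof.
apply: ae_eq_Rintegral; [|exact: measurable_L2M|].
  by apply: measurable_funM => //; exact: measurable_Lspace.
have := bounded_L2E nu (mphir s) (fun j => phi1 (j, s)).
by apply: filterS => j /(_ I) <- _.
Qed.

(** Since [<Te,e>] is the integral of (Se)^2, the sum is the integral over t of the sum of
    [<phi_row t, e>^2]. Bessel bounds this integrand by the squared norm of [phi_row t], which is at
    most 1. *)
Lemma gram_op_trace_le1 (s : seq L2) : uniq s ->
  {in s &, forall e e', L2dot e e' = (e == e')%:R} ->
  \sum_(e <- s) L2dot (gram_op e) e <= 1.
Proof.
move=> us os.
pose F (r : seq L2) t := \sum_(e <- r) gram_factor e t ^+ 2.
have mF2 e : measurable_fun setT (fun t => gram_factor e t ^+ 2).
  by apply: measurable_funX; exact: measurable_gram_factor.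
have i2 e : P.-integrable setT (EFin \o (fun t => gram_factor e t ^+ 2)).
  apply: (@bounded_integrable _ _ _ _ _ (`|e| ^+ 2)) => // t.
  by rewrite normrX lerXn2r ?nnegrE// normr_gram_factor.
have [iF ->] : P.-integrable setT (EFin \o F s) /\
    \sum_(e <- s) L2dot (gram_op e) e = \int[P]_t F s t.
  rewrite /F; elim: s {us os} => [|e r [iF IH]].
    split; first by under eq_fun do rewrite big_nil; exact: integrable0.
    rewrite big_nil; under eq_Rintegral do rewrite big_nil.
    by rewrite Rintegral_cst_probability.
  split.
    have := integrableD measurableT (i2 e) iF; apply: eq_integrable => //.
    by move=> t _ /=; rewrite big_cons.
  rewrite big_cons; under eq_Rintegral do rewrite big_cons.
  by rewrite RintegralD// IH gram_op_dot.
rewrite -[leRHS](Rintegral_cst_probability P); apply: le_Rintegral => //.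
  by apply: (@bounded_integrable _ _ _ _ _ 1) => // x; rewrite normr1.
move=> t _; rewrite /F; under eq_bigr do rewrite gram_factor_dot.
rewrite (le_trans (bessel (phi_row t) us os))// -L2norm_sqr.
rewrite expr_le1//; apply: L2norm_le => //.
have := bounded_L2E nu (mphir t) (fun j => phi1 (j, t)).
by apply: filterS => j /(_ I) ->.
Qed.

(* As gram_op is positive and self-adjoint, it is its own absolute value. *)
Lemma gram_op_trace_class : trace_class_op (@L2dot _ _ _ nu) gram_op.
Proof.
split; first exact: gram_op_bounded.
exists gram_op; split.
  split; [exact: gram_op_bounded|exact: gram_op_self_adjoint|exact: gram_op_positive|].
  by exists gram_op; [exact: gram_op_self_adjoint|].
have [E oE] := exists_orthonormal_basis nu.
exists E => //; apply: (@le_lt_trans _ _ 1%:E); last exact: ltry.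
(* An [\esum] is the supremum of its finite partial sums, and each finite subset of E is an
   orthonormal sequence. *)
apply: ub_ereal_sup => _ [F [finF FE] <-].
rewrite fsbig_finite// sumEFin lee_fin gram_op_trace_le1 ?fset_uniq// => e e'.
rewrite !in_fset_set// !inE => Fe Fe'.
by apply: oE.1; exact: FE.
Qed.

End gram_operator.

(** * Compactness *)

Lemma eval_ptws_continuous (X : eqType) (R : topologicalType) (x : X) :
  continuous (fun g : {ptws X -> R} => g x).
Proof. exact: (@proj_continuous X (fun=> R) x). Qed.

Lemma near_ptws_eval (X : eqType) (R : realType) (g : {ptws X -> R}) (x : X) (e : R) :
  0 < e -> \forall h \near g, `|g x - h x| <= e.
Proof.
have := @eval_ptws_continuous X R x g => /cvgrPdist_le h.
exact: h.
Qed.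

(** * Bounded Lipschitz families over a totally bounded index set *)

Section lipschitz_family.
Context d (X : measurableType d) (R : realType) (nu : probability X R).
Variables (w : X -> X -> R) (M : R).
Hypothesis mw : forall q, measurable_fun setT (w ^~ q).
Hypothesis w_tb : forall eps : R, 0 < eps -> exists s : seq X, forall j,
  exists2 i, (i < size s)%N & w j (nth point s i) <= eps.
Hypothesis M0 : 0 <= M.
Local Notation L2 := (LspaceType2 nu).

(** Genuine functions rather than a.e. classes, in the pointwise topology, so that Tychonoff's
    theorem applies. *)
Definition lipschitz_family : set {ptws X -> R} :=
  [set g | forall j l, `|g j| <= M /\ `|g j - g l| <= M * w j l].

Lemma compact_lipschitz_family : compact lipschitz_family.
Proof.
have cb := @tychonoff X (fun=> R) (fun=> `[- M, M]%classic)
  (fun=> @segment_compact R (- M) M).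
apply: (subclosed_compact _ cb); last first.
  move=> g gM j /=; rewrite in_itv/= -ler_norml; exact: (gM j j).1.
(* Each condition constrains one or two evaluations, which are continuous, so the family is an
   intersection of closed sets. *)
rewrite (_ : lipschitz_family = \bigcap_jl
  ([set g : {ptws X -> R} | `|g jl.1| <= M] `&`
   [set g | `|g jl.1 - g jl.2| <= M * w jl.1 jl.2])); last first.
  by apply/seteqP; split => g gM; [move=> [j l] _; exact: gM|
    move=> j l; exact: (gM (j, l) I)].
apply: closed_bigI => -[j l] _ /=; apply: closedI.
  apply: (@preimage_closed _ _ (fun g : {ptws X -> R} => `|g j|) [set x | x <= M]).
    by move=> g _; apply: (@continuous_comp _ _ _ (fun g : {ptws X -> R} => g j) Num.norm);
      [exact: eval_ptws_continuous|exact: norm_continuous].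
  exact: closed_le.
apply: (@preimage_closed _ _ (fun g : {ptws X -> R} => `|g j - g l|) [set x | x <= M * w j l]).
  move=> g _.
  apply: (@continuous_comp _ _ _ (fun g : {ptws X -> R} => g j - g l) Num.norm).
    by apply: continuousB; exact: eval_ptws_continuous.
  exact: norm_continuous.
exact: closed_le.
Qed.

(* McShane: a Lipschitz function is the supremum of g q - M w(., q) over any
   dense sequence of points q. *)
Lemma measurable_lipschitz_family (g : X -> R) :
  lipschitz_family g -> measurable_fun setT g.
Proof.
move=> gM.
have /choice[s sP] m : exists s : seq X, forall j,
    exists2 i, (i < size s)%N & w j (nth point s i) <= m.+1%:R^-1.
  by apply: w_tb; rewrite invr_gt0 ltr0n.
(* [D] lists the points of all the nets through codes of pairs (net, position). The default [point]
   at other codes is harmless, since [u n j <= g j] holds for any point. *)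
pose D n := if choice.unpickle n is Some mk then nth point (s mk.1) mk.2 else point.
pose u n j := g (D n) - M * w j (D n).
have ug n j : u n j <= g j.
  by rewrite /u; have [_] := gM j (D n); rewrite ler_norml => /andP[]; lra.
have ub j : has_ubound (range (u ^~ j)) by exists (g j) => _ [n _ <-]; exact: ug.
rewrite (_ : g = fun j => sups (u ^~ j) 0).
  apply: measurable_fun_sups => // n.
  by apply: measurable_funB => //; apply: measurable_funM.
apply/funext => j; apply/eqP; rewrite eq_le; apply/andP; split; last first.
  apply: ge_sup; first by exists (u 0%N j); exists 0%N.
  by move=> _ [n _ <-]; exact: ug.
suff e_bound (e : R) : 0 < e -> g j <= sups (u ^~ j) 0 + e by exact/ler_addgt0Pr.
(* At a net point within a of j, [u] falls short of g by at most 2Ma: M w is lost in g and M w is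
   subtracted. Taking a = e / (2M + 1) keeps the denominator positive. *)
move=> e0; have c0 : 0 < 2 * M + 1 by rewrite ltr_pwDr// mulr_ge0.
have e1 : 0 < e / (2 * M + 1) by rewrite divr_gt0.
have [N _ /(_ N (leqnn _)) /= Ne] := near_infty_natSinv_lt (PosNum e1).
have [i _ ji] := sP N j.
have Dq : D (choice.pickle (N, i)) = nth point (s N) i by rewrite /D choice.pickleK.
have : u (choice.pickle (N, i)) j <= sups (u ^~ j) 0.
  apply: ub_le_sup; first by have [b bP] := ub j; exists b => _ [n _ <-]; apply: bP; exists n.
  by exists (choice.pickle (N, i)).
have [_] := gM j (D (choice.pickle (N, i))); rewrite /u Dq ler_norml => /andP[_ h] h'.
have : M * w j (nth point (s N) i) <= M * (e / (2 * M + 1)).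
  by rewrite ler_wpM2l// (le_trans ji)// ltW.
have : (2 * M + 1) * (e / (2 * M + 1)) = e by rewrite mulrC divfK// gt_eqF.
by move: h h' e1; set a := e / _; set v := M * w _ _; nra.
Qed.

(** The a.e. class map, made total by the value 0 outside the family; its continuity is only claimed
    within the family. *)
Let cls (g : {ptws X -> R}) : L2 :=
  match pselect (lipschitz_family g) with
  | left h => bounded_L2 nu (measurable_lipschitz_family h) (fun j => (h j j).1)
  | right _ => 0
  end.

Let cls_ae g : lipschitz_family g -> (cls g : X -> R) = g %[ae nu].
Proof. by rewrite /cls; case: pselect => // h _; exact: bounded_L2E. Qed.

(* Two members of the family that are close on a finite net are uniformly close. *)
Let normr_clsB (s : seq X) a g h : 0 < a -> lipschitz_family g -> lipschitz_family h ->
  (forall j, exists2 i, (i < size s)%N & w j (nth point s i) <= a) ->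
  (forall i : 'I_(size s), `|g (nth point s i) - h (nth point s i)| <= a) ->
  `|cls g - cls h| <= (2 * M + 1) * a.
Proof.
move=> a0 gM hM sP gh.
apply: L2norm_le; first by rewrite mulr_ge0 ?ltW// ltr_pwDr// mulr_ge0.
near=> j.
have -> : (cls g - cls h : L2) j = cls g j - cls h j.
  by near: j; apply: filterS (LspaceB (cls g) (cls h)) => j /(_ I).
have -> : cls g j = g j by near: j; apply: filterS (cls_ae gM) => j /(_ I).
have -> : cls h j = h j by near: j; apply: filterS (cls_ae hM) => j /(_ I).
have [i si ji] := sP j; set q := nth point s i in ji.
have := gh (Ordinal si); rewrite /= -/q => ghq.
have [_ gj] := gM j q; have [_ hj] := hM j q.
have Mw : M * w j q <= M * a by rewrite ler_wpM2l.
(* Passing through the net point q costs two Lipschitz errors Ma and one net error a, whence (2M +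
   1) a. *)
rewrite (_ : g j - h j = (g j - g q) + (g q - h q) - (h j - h q)); last by ring.
rewrite (le_trans (ler_normB _ _))//; have := ler_normD (g j - g q) (g q - h q).
by lra.
Unshelve. all: by end_near. Qed.

Let continuous_cls : {within lipschitz_family, continuous cls}.
Proof.
have c0 : 0 < 2 * M + 1 by rewrite ltr_pwDr// mulr_ge0.
apply/subspace_continuousP => g gM; apply/cvgrPdist_le => e e0.
have a0 : 0 < e / (2 * M + 1) by rewrite divr_gt0.
have [s sP] := w_tb a0.
(* The net is finite, so closeness on all of it is a neighbourhood of g for pointwise
   convergence. *)
have gs : \forall h \near (g : {ptws X -> R}), forall i : 'I_(size s),
    `|g (nth point s i) - h (nth point s i)| <= e / (2 * M + 1).
  apply: (@filter_forall _ 'I_(size s)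
    (fun i h => `|g (nth point s i) - h (nth point s i)| <= e / (2 * M + 1)) _
    (nbhs_filter (g : {ptws X -> R}))) => i.
  exact: near_ptws_eval.
have eE : e = (2 * M + 1) * (e / (2 * M + 1)) by rewrite mulrC divfK// gt_eqF.
have H h : (forall i : 'I_(size s),
    `|g (nth point s i) - h (nth point s i)| <= e / (2 * M + 1)) ->
    lipschitz_family h -> `|cls g - cls h| <= e.
  by move=> gh hM; rewrite eE; exact: normr_clsB sP gh.
exact: (@filterS _ (nbhs (g : {ptws X -> R})) _ _ _ H gs).
Qed.

Lemma precompact_lipschitz (B : set L2) :
  (forall x, B x -> exists2 g, lipschitz_family g & (x : X -> R) = g %[ae nu]) ->
  precompact B.
Proof.
move=> BP.
have : precompact (cls @` lipschitz_family).
  apply: compact_precompact; first exact: norm_hausdorff.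
  exact: continuous_compact continuous_cls compact_lipschitz_family.
apply: precompact_subset => x /BP[g gM xg]; exists g => //.
by apply: Lspace_eq; apply: ae_eq_trans (cls_ae gM) (ae_eq_sym xg).
Qed.

End lipschitz_family.

(** * Compactness of Gram operators *)

Section gram_operator_compact.
Context d1 d2 (X : measurableType d1) (S : measurableType d2) (R : realType).
Context (nu : probability X R) (P : probability S R).
Variable phi : X * S -> R.
Hypothesis mphi : measurable_fun setT phi.
Hypothesis phi1 : forall z, `|phi z| <= 1.
Hypothesis phi_tb : forall eps : R, 0 < eps -> exists s : seq X, forall j,
  exists2 i, (i < size s)%N &
    \int[P]_t `|phi (j, t) - phi (nth point s i, t)| <= eps.

Let mphil j : measurable_fun setT (fun s => phi (j, s)).
Proof. exact: measurableT_comp. Qed.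

Let w j q := \int[P]_t `|phi (j, t) - phi (q, t)|.

Let norm_phiB x y : `|phi x - phi y| <= 2.
Proof. by rewrite (le_trans (ler_normB _ _))//; have := phi1 x; have := phi1 y; lra. Qed.

Let mw q : measurable_fun setT (w ^~ q).
Proof.
rewrite (_ : w ^~ q = fun j => \int[P]_s (`|phi (j, s) - phi (q, (j, s).2)| * 1)).
  apply: (@measurable_kernel_l _ _ X S R nu P
    (fun z => `|phi z - phi (q, z.2)|) 2 (fun=> 1)) => //.
  - apply: measurableT_comp => //; apply: measurable_funB => //.
    by apply: (@measurableT_comp _ _ _ _ _ _ (fun s => phi (q, s))).
  - by move=> z; rewrite normr_id.
  - by apply: (@bounded_integrable _ _ _ _ _ 1) => // x; rewrite normr1.
by apply/funext => l; apply: eq_Rintegral => s _; rewrite mulr1.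
Qed.

(** The representative [gram_fun] lies in the Lipschitz family: Tf(j) - Tf(l) is the integral of
    (phi_j - phi_l) Sf, and |Sf| is at most the norm of f, hence at most M. *)
Lemma gram_op_compact : compact_op (@gram_op _ _ X S R nu P phi mphi phi1).
Proof.
move=> B /pinfty_ex_gt0[M M0 BM].
apply: (precompact_lipschitz mw phi_tb (ltW M0)) => _ [f /BM /= fM <-].
exists (gram_fun P phi f); last exact: gram_opE.
move=> j l; split; first by apply: le_trans fM; exact: normr_gram_fun.
have bd j' t : `|phi (j', t) * gram_factor phi f t| <= M.
  rewrite normrM -[leRHS]mul1r ler_pM//.
  by apply: le_trans fM; exact: normr_gram_factor.
have mm j' : measurable_fun setT (fun t => phi (j', t) * gram_factor phi f t).
  by apply: measurable_funM => //; exact: measurable_gram_factor.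
have ii j' : P.-integrable setT (EFin \o (fun t => phi (j', t) * gram_factor phi f t)).
  exact: bounded_integrable.
rewrite !gram_funE// -RintegralB//.
have iB : P.-integrable setT (EFin \o (fun t => phi (j, t) * gram_factor phi f t -
    phi (l, t) * gram_factor phi f t)).
  by have := integrableB measurableT (ii j) (ii l); exact: eq_integrable.
have mB : measurable_fun setT (fun t => `|phi (j, t) - phi (l, t)|).
  by apply: measurableT_comp => //; exact: measurable_funB.
rewrite (le_trans (le_normr_Rintegral measurableT iB))//.
have iw : P.-integrable setT (EFin \o (fun t => `|phi (j, t) - phi (l, t)|)).
  by apply: (@bounded_integrable _ _ _ _ _ 2) => // t; rewrite normr_id.
rewrite /w -RintegralZl//; apply: le_Rintegral => //.
- by have := integrable_abse iB; exact: eq_integrable.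
- by have := integrableZl measurableT M iw; exact: eq_integrable.
move=> t _; rewrite -mulrBl normrM mulrC ler_wpM2r//.
by apply: le_trans fM; exact: normr_gram_factor.
Qed.

End gram_operator_compact.

(** * The corner kernel *)

Section probability_indicator.
Context d (T : measurableType d) (R : realType) (P : probability T R).
Implicit Types A B : set T.

Lemma fine_probability_ge0 A : 0 <= fine (P A).
Proof. exact: fine_ge0. Qed.

Lemma fine_probability_le1 A : measurable A -> fine (P A) <= 1.
Proof.
move=> mA; rewrite -[leRHS]/(fine 1%:E) fine_le ?probability_le1//.
exact: fin_num_measure.
Qed.

Lemma Rintegral_indic A : measurable A -> \int[P]_t (\1_A t : R) = fine (P A).
Proof. by move=> mA; rewrite /Rintegral integral_indic// setIT. Qed.

Lemma integrable_indic A : measurable A -> P.-integrable setT (EFin \o (\1_A : T -> R)).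
Proof.
move=> mA; apply: (@bounded_integrable _ _ _ _ _ 1) => //.
by move=> t; rewrite ger0_norm// indicE lern1; case: (_ \in _).
Qed.

Lemma covariance_indic A B : measurable A -> measurable B ->
  \int[P]_t ((\1_A t - fine (P A)) * (\1_B t - fine (P B))) =
  fine (P (A `&` B)) - fine (P A) * fine (P B).
Proof.
move=> mA mB; have mAB := measurableI _ _ mA mB.
set a := fine (P A); set b := fine (P B).
have iZ c C : measurable C -> P.-integrable setT (EFin \o (fun t => c * (\1_C t : R))).
  move=> /integrable_indic iC.
  by have := integrableZl measurableT c iC; exact: eq_integrable.
have ic : P.-integrable setT (EFin \o (fun _ : T => a * b)).
  exact: (@bounded_integrable _ _ _ _ _ `|a * b|).
transitivity (\int[P]_t (\1_(A `&` B) t - (b * \1_A t + a * \1_B t - a * b))).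
  by apply: eq_Rintegral => t _; rewrite indicI/=; ring.
have i1 : P.-integrable setT (EFin \o (fun t => b * (\1_A t : R) + a * (\1_B t : R))).
  by have := integrableD measurableT (iZ b _ mA) (iZ a _ mB); exact: eq_integrable.
have i2 : P.-integrable setT
    (EFin \o (fun t => b * (\1_A t : R) + a * (\1_B t : R) - a * b)).
  by have := integrableB measurableT i1 ic; exact: eq_integrable.
rewrite (RintegralB measurableT (integrable_indic mAB) i2).
rewrite (RintegralB measurableT i1 ic).
rewrite (RintegralD measurableT (iZ b _ mA) (iZ a _ mB)).
rewrite (RintegralZl b measurableT (integrable_indic mA)).
rewrite (RintegralZl a measurableT (integrable_indic mB)).
rewrite !Rintegral_indic// Rintegral_cst_probability -/a -/b; ring.
Qed.

Lemma probability_bigsetU_le n (F : 'I_n -> set T) : (forall i, measurable (F i)) ->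
  fine (P (\big[setU/set0]_i F i)) <= \sum_i fine (P (F i)).
Proof.
move=> mF.
suff [] : measurable (\big[setU/set0]_i F i) /\
  fine (P (\big[setU/set0]_i F i)) <= \sum_i fine (P (F i)) by [].
elim/big_ind2 : _ => [|A x B y [mA Ax] [mB By]|i _] //.
  by split=> //; rewrite measure0.
split; first exact: measurableU.
rewrite (le_trans _ (lerD Ax By))// -fineD ?fin_num_measure//.
rewrite fine_le ?fin_numD ?fin_num_measure//; first exact: measurableU.
exact: measureU2.
Qed.

End probability_indicator.

(** The uniform density is at most 1, so Lebesgue measure dominates. *)
Lemma uniform_prob_le (R : realType) (U : set (measurableTypeR R)) (a b : R) :
  measurable U -> U `<=` `[a, b]%classic -> a <= b ->
  fine (uniform_prob (@ltr01 R) U) <= b - a.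
Proof.
move=> mU Uab ab.
have : (uniform_prob (@ltr01 R) U <= (b - a)%:E)%E.
  rewrite /uniform_prob (@le_trans _ _ (\int[lebesgue_measure]_(x in U) 1)%E)//.
    apply: ge0_le_integral => //=.
    - by move=> x _; rewrite lee_fin uniform_pdf_ge0.
    - apply/measurable_EFinP/measurable_funTS; exact: measurable_uniform_pdf.
    - move=> x _; rewrite lee_fin /uniform_pdf; case: ifP => // _.
      by rewrite subr0 invr1.
  have hU : (lebesgue_measure U <= lebesgue_measure (`[a, b]%classic : set R))%E.
    by apply: le_measure; rewrite ?inE.
  rewrite integral_cst//= mul1e (le_trans hU)//.
  rewrite lebesgue_measure_itv/= lte_fin.
  by case: ltP => // _; rewrite lee_fin subr_ge0.
move=> h; rewrite -lee_fin fineK//; exact: fin_num_measure.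
Qed.

(** * Corner boxes: measurability, covariance kernel and grid approximation *)

Section corner_kernel.
Context (R : realType) (d : nat).
Local Notation mR := (measurableTypeR R).
Local Notation tup := (d.-tuple mR).
Local Notation Corner := (d.-tuple bool).
Local Notation P := (P0 R d).
Local Notation idx := (Corner * tup)%type.

Definition side (c : bool) (p : R) : set mR :=
  [set x : R | 0 <= x <= 1 /\ (if c then p <= x else x <= p)].

Lemma measurable_side c p : measurable (side c p).
Proof.
rewrite (_ : side c p = `[0, 1]%classic `&`
    (if c then `[p, +oo[%classic else `]-oo, p]%classic)).
  by apply: measurableI => //; case: c.
by apply/seteqP; split => x; rewrite /side /= ?in_itv/=; case: c; rewrite /= ?in_itv/= ?andbT.
Qed.

(** Gathers the boxes A_j into one set whose sections they are; its measurability gives the joint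
    measurability in (j, s) that Fubini requires. *)
Definition graphA : set (idx * tup) := [set z | A_ (z.1 : idx) z.2].

Lemma measurable_graphA : measurable graphA.
Proof.
(* The conditional on the corner bit is written with boolean connectives, for which measurability is
   compositional. *)
pose f k (z : idx * tup) := let sk : R := tnth z.2 k in let pk : R := tnth z.1.2 k in
  (0 <= sk <= 1) && ((tnth z.1.1 k && (pk <= sk)) || (~~ tnth z.1.1 k && (sk <= pk))).
rewrite (_ : graphA = \bigcap_(k in [set: 'I_d]) (f k @^-1` [set true])).
  apply: fin_bigcap_measurable => // k _; rewrite -[_ @^-1` _]setTI.
  have ms : measurable_fun setT (fun z : idx * tup => tnth z.2 k : mR).
    by apply: (measurableT_comp (measurable_tnth k)).
  have mp : measurable_fun setT (fun z : idx * tup => tnth z.1.2 k : mR).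
    apply: (measurableT_comp (measurable_tnth k)).
    exact: (measurableT_comp measurable_snd measurable_fst).
  have mc : measurable_fun setT (fun z : idx * tup => tnth z.1.1 k).
    apply: (measurableT_comp (measurable_tnth k)).
    exact: (measurableT_comp measurable_fst measurable_fst).
  have mf : measurable_fun setT (f k).
    apply: measurable_and; first by apply: measurable_and; exact: measurable_fun_ler.
    by apply: measurable_or; apply: measurable_and => //;
      [exact: measurable_fun_ler|exact: measurable_neg|exact: measurable_fun_ler].
  exact: mf.
apply/seteqP; split => z h.
  move=> k _ /=; have [h0] := h k; rewrite /f h0 /=.
  by case: (tnth z.1.1 k) => /= ->.
move=> k /=; have /andP[-> ] := h k I.
by case: (tnth z.1.1 k) => /=; rewrite ?orbF => ->.
Qed.

Lemma xsection_graphA (j : idx) : xsection graphA j = A_ j.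
Proof. by apply/seteqP; split => s; rewrite /xsection /= inE. Qed.

Lemma measurable_A (j : idx) : measurable (A_ j).
Proof. by rewrite -xsection_graphA; apply: measurable_xsection; exact: measurable_graphA. Qed.

Definition centered_indicator (z : idx * tup) : R :=
  \1_graphA z - fine (P (A_ (z.1 : idx))).

Lemma centered_indicatorE (j : idx) s : centered_indicator (j, s) = \1_(A_ j) s - fine (P (A_ j)).
Proof.
by congr (_%:R - _); congr nat_of_bool; apply/idP/idP; rewrite !inE.
Qed.

Lemma measurable_centered_indicator : measurable_fun setT centered_indicator.
Proof.
apply: measurable_funB; first exact: measurable_indic measurable_graphA.
apply: (@measurableT_comp _ _ _ _ _ _ (fun j : idx => fine (P (A_ j)))) => //.
rewrite (_ : (fun j : idx => fine (P (A_ j))) = fine \o (P \o xsection graphA)).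
  by apply: measurableT_comp => //; exact: measurable_fun_xsection measurable_graphA.
by apply/funext => j /=; rewrite xsection_graphA.
Qed.

Lemma normr_centered_indicator z : `|centered_indicator z| <= 1.
Proof.
rewrite /centered_indicator; have := fine_probability_ge0 P (A_ z.1).
have := fine_probability_le1 P (measurable_A z.1).
rewrite indicE ler_norml; case: (_ \in _) => /=; lra.
Qed.

Lemma K_gram (j l : idx) : K_ j l = gram_kernel P centered_indicator j l.
Proof.
rewrite /K_ -covariance_indic; [|exact: measurable_A|exact: measurable_A].
by apply: eq_Rintegral => s _; rewrite !centered_indicatorE.
Qed.

Let slab (k : 'I_d) (U : set mR) : set tup := [set s | U (tnth s k)].

Let measurable_slab k U : measurable U -> measurable (slab k U).
Proof.
move=> mU; rewrite -[slab k U]setTI.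
by have := measurable_tnth k; apply.
Qed.

(** A slab is a box whose other sides are the whole line, each of mass 1. *)
Let P_slab k U : measurable U -> P (slab k U) = uniform_prob (@ltr01 R) U.
Proof.
move=> mU; pose B i := if i == k then U else [set: mR].
rewrite (_ : slab k U = [set s | forall i, B i (tnth s i)]).
  rewrite P0_box; last by move=> i; rewrite /B; case: ifP.
  rewrite (bigD1 k)//= {1}/B eqxx big1 ?mule1// => i /negbTE ik.
  by rewrite /B ik; exact: probability_setT.
apply/seteqP; split => s /=.
  by move=> Us i; rewrite /B; case: eqP => // ->.
by move=> /(_ k); rewrite /B eqxx.
Qed.

(** Put D = A_j \ A_q. As A_q is inside A_j, the centered indicators differ by 1_D - P(D), of L1
    norm at most 2 P(D). A point of D violates some side of A_q, so D is covered by d slabs of mass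
    at most e. *)
Lemma L1dist_centered_indicator (j q : idx) (e : R) :
  (forall k, side (tnth q.1 k) (tnth q.2 k) `<=` side (tnth j.1 k) (tnth j.2 k) /\
     fine (uniform_prob (@ltr01 R)
       (side (tnth j.1 k) (tnth j.2 k) `\` side (tnth q.1 k) (tnth q.2 k))) <= e) ->
  \int[P]_s `|centered_indicator (j, s) - centered_indicator (q, s)| <= 2 * (d%:R * e).
Proof.
move=> jq.
have qj : A_ q `<=` A_ j by move=> s h k; apply: (jq k).1; exact: h.
have mj := measurable_A j; have mq := measurable_A q.
have mjq := measurableD mj mq.
have Pjq : fine (P (A_ j)) - fine (P (A_ q)) = fine (P (A_ j `\` A_ q)).
  rewrite measureD//; last by rewrite ltey_eq fin_num_measure.
  by rewrite setIidr// fineB// fin_num_measure.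
have dP : fine (P (A_ j `\` A_ q)) <= d%:R * e.
  pose U k := side (tnth j.1 k) (tnth j.2 k) `\` side (tnth q.1 k) (tnth q.2 k).
  have mU k : measurable (U k) by apply: measurableD; exact: measurable_side.
  have mUk k : measurable (slab k (U k)) by exact: measurable_slab.
  have sub : A_ j `\` A_ q `<=` \big[setU/set0]_k slab k (U k).
    move=> s [js qs]; apply: contrapT => h; apply: qs => k; apply: contrapT => ks.
    by apply: h; rewrite (bigD1 k)//=; left; split => //; exact: js.
  rewrite (@le_trans _ _ (fine (P (\big[setU/set0]_k slab k (U k)))))//.
    have mUU : measurable (\big[setU/set0]_k slab k (U k)).
      by apply: bigsetU_measurable => k _; exact: mUk.
    by rewrite fine_le ?fin_num_measure//; apply: le_measure; rewrite ?inE.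
  rewrite (le_trans (probability_bigsetU_le P mUk))//.
  rewrite -[d in d%:R]card_ord mulr_natl -sumr_const; apply: ler_sum => k _.
  by rewrite P_slab//; exact: (jq k).2.
rewrite (@le_trans _ _ (\int[P]_s (\1_(A_ j `\` A_ q) s + fine (P (A_ j `\` A_ q)))))//.
  have ic (c : R) : P.-integrable setT (EFin \o (fun _ : tup => c)).
    exact: (@bounded_integrable _ _ _ _ _ `|c|).
  have mphi i : measurable_fun setT (fun s => centered_indicator (i, s)).
    by apply: measurableT_comp => //; exact: measurable_centered_indicator.
  apply: le_Rintegral => //.
  - apply: (@bounded_integrable _ _ _ _ _ 2).
      by apply: measurableT_comp => //; exact: measurable_funB.
    move=> s; rewrite normr_id (le_trans (ler_normB _ _))//.
    have := normr_centered_indicator (j, s).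
    by have := normr_centered_indicator (q, s); lra.
  - have := integrableD measurableT (integrable_indic P mjq) (ic (fine (P (A_ j `\` A_ q)))).
    exact: eq_integrable.
  move=> s _; rewrite !centered_indicatorE -Pjq.
  have -> : \1_(A_ j) s - fine (P (A_ j)) - (\1_(A_ q) s - fine (P (A_ q))) =
    \1_(A_ j `\` A_ q) s - fine (P (A_ j `\` A_ q)) :> R.
    rewrite -Pjq !indicE in_setD.
    have [sq|sq] := boolP (s \in A_ q); last first.
      rewrite /= andbT; ring.
    have -> : s \in A_ j by apply/mem_set; apply: qj; exact: set_mem.
    by rewrite /= mulr0n mulr1n; ring.
  rewrite Pjq (le_trans (ler_normB _ _))// !ger0_norm//; exact: fine_probability_ge0.
rewrite RintegralD//; [|exact: integrable_indic|].
  by rewrite Rintegral_indic// Rintegral_cst_probability; lra.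
exact: (@bounded_integrable _ _ _ _ _ `|fine (P (A_ j `\` A_ q))|).
Qed.

(** Grid of mesh 1/(n+1), measured from 0 or from 1 according to c. The shift to [i.+1] turns
    truncation into rounding up, which shrinks the side. *)
Let node (n : nat) (c : bool) (i : nat) : R :=
  let t := i.+1%:R / n.+1%:R in if c then t else 1 - t.

(** The reflected coordinate stays in [0, 1]: a threshold below 0 acts like 0, and one above 2
    excludes every x, just as 2 does. *)
Let side_clamp c (p x : R) : side c p x <-> 0 <= x <= 1 /\
  Num.min (Num.max (if c then p else 1 - p) 0) 2 <= (if c then x else 1 - x).
Proof.
rewrite /side /= ge_min ge_max; split => -[/andP[x0 x1] h]; (split; first exact/andP).
  by case: c h => h; apply/orP; left; apply/andP; split; lra.
by case: c h => /orP[/andP[]|]; lra.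
Qed.

Let side_node n c i (x : R) : side c (node n c i) x <->
  0 <= x <= 1 /\ i.+1%:R / n.+1%:R <= (if c then x else 1 - x).
Proof.
by rewrite /side /node /=; case: c; split => -[h ht]; split => //;
  move: ht; set t := _ / _; lra.
Qed.

(* Positions are rounded towards the inside of the box, so that the boxes shrink.
   Reflecting x to 1 - x reduces the upper bounds to the lower ones, and clamping
   to [0, 2] bounds the number of nodes. *)
Let node_approx n c p : exists2 i, (i < (2 * n.+1).+1)%N &
  side c (node n c i) `<=` side c p /\
  fine (uniform_prob (@ltr01 R) (side c p `\` side c (node n c i))) <= n.+1%:R^-1.
Proof.
pose p1 := if c then p else 1 - p.
pose p2 := Num.min (Num.max p1 0) 2.
have n0 : 0 < n.+1%:R :> R by rewrite ltr0n.
have p20 : 0 <= p2 by rewrite le_min ler0n le_max lexx orbT.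
have p22 : p2 <= 2 by rewrite ge_min lexx orbT.
have /andP[ti it] := truncn_itv (mulr_ge0 p20 (ltW n0)).
set i := Num.truncn (p2 * n.+1%:R) in ti it.
have ti' : i%:R / n.+1%:R <= p2 by rewrite ler_pdivrMr.
have it' : p2 < i.+1%:R / n.+1%:R by rewrite ltr_pdivlMr.
have iE : i.+1%:R / n.+1%:R = i%:R / n.+1%:R + n.+1%:R^-1 :> R.
  by rewrite -natr1 mulrDl mul1r.
exists i.
  (* Clamping gives p2 <= 2, so i is at most 2(n+1). *)
  rewrite ltnS -(ler_nat R) (le_trans ti)// natrM ler_wpM2r//.
have sideE (x : R) : side c p x <-> 0 <= x <= 1 /\ p2 <= (if c then x else 1 - x).
  exact: side_clamp.
have nodeE (x : R) : side c (node n c i) x <->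
    0 <= x <= 1 /\ i.+1%:R / n.+1%:R <= (if c then x else 1 - x).
  exact: side_node.
split=> [x /nodeE[x01 xi]|].
  by apply/sideE; split=> //; rewrite (le_trans (ltW it')).
have mD : measurable (side c p `\` side c (node n c i)).
  by apply: measurableD; exact: measurable_side.
(* The points lost by rounding lie between p2 and the next node, up to reflection: an interval of
   length at most the mesh. *)
pose a := if c then p2 else 1 - i.+1%:R / n.+1%:R.
pose b := if c then i.+1%:R / n.+1%:R else 1 - p2.
have ab : b - a = i.+1%:R / n.+1%:R - p2 by rewrite /a /b; case: (c); ring.
rewrite (@le_trans _ _ (b - a))//; last first.
  by rewrite ab iE addrAC -[leRHS]add0r lerD2r subr_le0.
apply: uniform_prob_le => //; last by rewrite -subr_ge0 ab subr_ge0 ltW.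
move=> x [/sideE[x01 px] nx] /=.
have : (if c then x else 1 - x) < i.+1%:R / n.+1%:R.
  by rewrite ltNge; apply/negP => h; apply: nx; exact/nodeE.
by move: px; rewrite in_itv/= /a /b; set t := _ / _; case: (c) => px h; apply/andP; split; lra.
Qed.

Lemma centered_indicator_totally_bounded (e : R) : 0 < e -> exists s : seq idx, forall j,
  exists2 i, (i < size s)%N &
    \int[P]_t `|centered_indicator (j, t) - centered_indicator (nth point s i, t)| <= e.
Proof.
move=> e0.
(* [L1dist_centered_indicator] yields 2d times the mesh; the added 1 keeps the denominator positive
   for every d. *)
have e1 : 0 < e / (2 * d%:R + 1) by rewrite divr_gt0// ltr_wpDl// mulr_ge0.
have [n _ /(_ n (leqnn _)) /= ne] := near_infty_natSinv_lt (PosNum e1).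
(* The finite net: the corner is kept exactly, and each coordinate is replaced by a grid node. *)
pose F := (Corner * {ffun 'I_d -> 'I_(2 * n.+1).+1})%type.
pose pt (x : F) : idx := (x.1, [tuple node n (tnth x.1 k) (x.2 k) | k < d]).
exists [seq pt x | x <- enum {: F}] => j.
have /choice[f fP] k : exists i : 'I_(2 * n.+1).+1,
    let c := tnth j.1 k in let p : R := tnth j.2 k in
    side c (node n c i) `<=` side c p /\
    fine (uniform_prob (@ltr01 R) (side c p `\` side c (node n c i))) <= n.+1%:R^-1.
  by have [i ilt h] := node_approx n (tnth j.1 k) (tnth j.2 k); exists (Ordinal ilt).
pose x : F := (j.1, [ffun k => f k]).
exists (index x (enum {: F})); first by rewrite size_map index_mem mem_enum.
rewrite (nth_map x) ?index_mem ?mem_enum// nth_index ?mem_enum//.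
rewrite (le_trans (@L1dist_centered_indicator j (pt x) n.+1%:R^-1 _))//.
  by move=> k; rewrite /pt /= tnth_mktuple ffunE; exact: fP.
rewrite mulrA (@le_trans _ _ ((2 * d%:R + 1) * (e / (2 * d%:R + 1))))//.
  rewrite ler_pM ?invr_ge0//; [by rewrite lerDl|exact: ltW].
by rewrite mulrC divfK// gt_eqF// ltr_wpDl// mulr_ge0.
Qed.

End corner_kernel.

Theorem theoremC2 (R : realType) (d : nat) (hd : (1 <= d)%N) :
  exists T : {linear LspaceType2 (nu R d) -> LspaceType2 (nu R d)},
    (forall f : LspaceType2 (nu R d),
       (T f : _ -> R) =
         (fun j => \int[nu R d]_l (K_ j l * f l)) %[ae (nu R d)]) /\
    [/\ bounded_op T,
        compact_op T,
        self_adjoint_op (@L2dot _ _ _ (nu R d)) T,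
        positive_op (@L2dot _ _ _ (nu R d)) T
      & trace_class_op (@L2dot _ _ _ (nu R d)) T].
Proof.
have mphi := @measurable_centered_indicator R d.
have phi1 := @normr_centered_indicator R d.
exists (@gram_op _ _ _ _ R (nu R d) (P0 R d) _ mphi phi1); split.
  move=> f; have := @gram_opE _ _ _ _ R (nu R d) (P0 R d) _ mphi phi1 f.
  rewrite (_ : gram_fun _ _ _ = fun j => \int[nu R d]_l (K_ j l * f l)) //.
  apply/funext => j.
  by apply: eq_Rintegral => l _; rewrite K_gram.
split.
- exact: gram_op_bounded.
- apply: gram_op_compact; exact: centered_indicator_totally_bounded.
- exact: gram_op_self_adjoint.
- exact: gram_op_positive.
- exact: gram_op_trace_class.
Qed.
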